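(* For fixed $n\ge 2$ there exists, for each $\epsilon>0$, a joint distribution of $X=(X_1,\dots,X_n)$ where $1\le X_1<X_2<\dots<X_n\le N(\epsilon)$ are all integers and $X$ has $\epsilon$-indistinguishable subsets, and $N(\epsilon)=\exp_2^{n-2}\left(\Theta\left(\frac1\epsilon\right)\right)$.
   Context: $\exp_2(x)=2^x$, and $\exp_2^{k}$ denotes its $k$-fold iterate (with $\exp_2^0(x)=x$). The notation $N(\epsilon)=\exp_2^{n-2}(\Theta(1/\epsilon))$ means that there are constants $c,C,\epsilon_0>0$, allowed to depend on $n$, such that $\exp_2^{n-2}(c/\epsilon)\le N(\epsilon)\le\exp_2^{n-2}(C/\epsilon)$ for all $\epsilon\in(0,\epsilon_0)$. The total variation distance between discrete random variables $A,B$ is $\delta(A,B)=\sum_x\max(\Pr(A=x)-\Pr(B=x),0)=\frac12\sum_x|\Pr(A=x)-\Pr(B=x)|$. $A$ and $B$ are $\epsilon$-indistinguishable if $\delta(A,B)\le\epsilon$. A tuple $(X_1,\dots,X_n)$ has $\epsilon$-indistinguishable $m$-subsets if for any two subsets $\{i_1,\dots,i_m\},\{j_1,\dots,j_m\}\subset\{1,\dots,n\}$ of size $m$, the random sets $\{X_{i_1},\dots,X_{i_m}\}$ and $\{X_{j_1},\dots,X_{j_m}\}$ are $\epsilon$-indistinguishable. It has $\epsilon$-indistinguishable subsets if it has $\epsilon$-indistinguishable $m$-subsets for all $m<n$. *)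

(* Defs.v *)
From HB Require Import structures.
From mathcomp Require Import all_boot all_order all_algebra.
From mathcomp Require Import reals exp.

Set Implicit Arguments.
Unset Strict Implicit.
Unset Printing Implicit Defensive.

Import Order.TTheory GRing.Theory Num.Theory.
Local Open Scope ring_scope.

Definition exp2 (R : realType) (x : R) : R := 2 `^ x.

(* f(eps) = exp_2^k (Theta (1 / eps)) as eps -> 0+. *)
Definition iter_exp2_Theta_inv (R : realType) (k : nat) (f : R -> R) : Prop :=
  exists c C eps0 : R,
    [/\ 0 < c, 0 < C, 0 < eps0 &
        forall eps : R, 0 < eps < eps0 ->
          iter k (@exp2 R) (c / eps) <= f eps <= iter k (@exp2 R) (C / eps)].

Definition is_distribution (R : realType) (T : finType) (p : {ffun T -> R}) :
    Prop :=
  (forall t, 0 <= p t) /\ \sum_t p t = 1.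

(* Pr(A = v) for a random variable A on the finite probability space (T, p). *)
Definition Pr_eq (R : realType) (T V : finType) (p : {ffun T -> R})
    (A : T -> V) (v : V) : R :=
  \sum_(t | A t == v) p t.

Definition tv_dist (R : realType) (T V : finType) (p : {ffun T -> R})
    (A B : T -> V) : R :=
  \sum_v Num.max (Pr_eq p A v - Pr_eq p B v) 0.

Definition indistinguishable (R : realType) (T V : finType)
    (p : {ffun T -> R}) (eps : R) (A B : T -> V) : Prop :=
  tv_dist p A B <= eps.

(* A joint distribution of n random variables with values in {0, ..., N} is a
   distribution p on {ffun 'I_n -> 'I_N.+1}; the variable X_(i+1) is then the
   evaluation x |-> x i, as 'I_n indexes from 0. *)

Definition random_subset (n N : nat) (I : {set 'I_n})
    (x : {ffun 'I_n -> 'I_N.+1}) : {set 'I_N.+1} :=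
  [set x i | i in I].

Definition indistinguishable_msubsets (R : realType) (n N : nat)
    (p : {ffun {ffun 'I_n -> 'I_N.+1} -> R}) (eps : R) (m : nat) : Prop :=
  forall I J : {set 'I_n}, #|I| = m -> #|J| = m ->
    indistinguishable p eps (@random_subset n N I) (@random_subset n N J).

Definition indistinguishable_subsets (R : realType) (n N : nat)
    (p : {ffun {ffun 'I_n -> 'I_N.+1} -> R}) (eps : R) : Prop :=
  forall m : nat, (m < n)%N -> indistinguishable_msubsets p eps m.

(* 1 <= X_1 < ... < X_n holds with probability one; the bound X_n <= N is built
   into the value type 'I_N.+1. *)
Definition positive_increasing (R : realType) (n N : nat)
    (p : {ffun {ffun 'I_n -> 'I_N.+1} -> R}) : Prop :=
  forall x : {ffun 'I_n -> 'I_N.+1}, 0 < p x ->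
    (forall i : 'I_n, (1 <= x i)%N) /\
    (forall i j : 'I_n, (i < j)%N -> (x i < x j)%N).

(* Main.v *)
Require Import Defs.
From mathcomp Require Import all_boot all_order all_algebra perm.
From mathcomp Require Import reals exp.
From mathcomp Require Import zify.
Import Order.TTheory GRing.Theory Num.Theory.
Set Implicit Arguments.
Unset Strict Implicit.
Unset Printing Implicit Defensive.

(* All variables are functions of a uniform seed in a finite set, and two
   functions of the seed are close when some permutation of the seeds matches
   them outside a set of density c / K; here K is of order 1 / eps.
   For n = 2 take (U, U + 1) with U uniform on K values.  For n = 3 take
   (W, W + 2^a, W + 2^(a+1)) with a uniform on K values and W uniform on a long
   interval: each of the three gaps is a power of 2 with an almost uniform
   exponent.  Given (Y_1, ..., Y_n) with n >= 3 and M = 2^K, take W uniform on a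
   long interval and (W, W + R_1, ..., W + R_n) with R_j uniform on
   [M^Y_j, 2 M^Y_j).  Moving the base point of a subset from W to its smallest
   element W + R_i perturbs the later increments R_j only negligibly, because
   R_i / M^Y_j <= 2 / M; so a subset of size m is described by a base point and
   by a subset of size m - 1 of the Y_j, whose ranks are hidden by induction.
   Each step costs one exponential in the range.  The lower bound on N comes for
   free, since N may be chosen as large as the upper bound permits. *)

(** * Events of small density in a finite set *)

Definition rare (T : finType) (K c : nat) (P : pred T) : bool :=
  #|P| * K <= c * #|T|.

Lemma rare_sub (T : finType) K c (P P' : pred T) :
  {subset P <= P'} -> rare K c P' -> rare K c P.
Proof.
move=> sPP'; apply: leq_trans; rewrite leq_mul2r subset_leq_card ?orbT //.
exact/subsetP.
Qed.

Lemma rare_predU (T : finType) K c d (P P' : pred T) :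
  rare K c P -> rare K d P' -> rare K (c + d) (predU P P').
Proof.
rewrite /rare mulnDl => cP dP'; apply: leq_trans (leq_add cP dP').
rewrite -mulnDl leq_mul2r -cardUI leq_addr orbT //.
Qed.

Lemma rare_exists (T I : finType) K c (P : I -> pred T) :
  (forall i, rare K c (P i)) -> rare K (#|I| * c) [pred t | [exists i, P i t]].
Proof.
move=> cP; rewrite /rare -mulnA -[X in _ <= X]sum_nat_const.
apply: (@leq_trans (\sum_i #|P i| * K)); last by apply: leq_sum => i _; apply: cP.
rewrite -big_distrl leq_mul2r /=.
apply/orP; right.
have -> : \sum_i #|P i| = \sum_t \sum_i (P i t : nat).
  rewrite exchange_big; apply: eq_bigr => i _.
  by rewrite -sum1_card big_mkcond; apply: eq_bigr => t _; rewrite unfold_in; case: (P i t).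
rewrite -sum1_card big_mkcond; apply: leq_sum => t _; rewrite inE.
by case: existsP => // -[i Pit]; rewrite (bigD1 i) //= Pit.
Qed.

Lemma rare_pair (A B : finType) K c (P : pred (A * B)) :
  (forall a, rare K c [pred b | P (a, b)]) -> rare K c P.
Proof.
move=> cP; rewrite /rare card_prod mulnCA -[X in _ <= X]sum_nat_const.
apply: (@leq_trans (\sum_a #|[pred b | P (a, b)]| * K));
  last by apply: leq_sum => a _; apply: cP.
rewrite -big_distrl leq_mul2r /=.
apply/orP; right; apply: eq_leq; rewrite -sum1_card.
under [RHS]eq_bigr do rewrite -sum1_card.
by rewrite pair_big_dep; apply: eq_bigl => -[a b]; rewrite inE.
Qed.

(** Only the coordinate [a] is constrained, so the event is a product set in which all other factors
    are full and cancel. *)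
Lemma rare_ffun (A B : finType) K c (a : A) (P : pred B) :
  rare K c P -> rare K c [pred f : {ffun A -> B} | P (f a)].
Proof.
rewrite {1}/rare => cP; pose F x := if x == a then P else predT.
have -> : rare K c [pred f : {ffun A -> B} | P (f a)] = rare K c (family F).
  rewrite /rare; congr (_ * _ <= _); apply: eq_card => f.
  apply/idP/familyP => [Pfa x | /(_ a)]; last by rewrite /F eqxx.
  by rewrite /F; case: (x =P a) => [->|].
rewrite /rare card_family card_ffun.
have -> : foldr muln 1 [seq #|F x| | x : A] = #|P| * #|B| ^ #|A|.-1.
  rewrite foldrE big_map big_enum /= (bigD1 a) //= {1}/F eqxx; congr (_ * _).
  rewrite (eq_bigr (fun=> #|B|)) => [|x /negPf xa]; last by rewrite /F xa; apply: eq_card.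
  by rewrite prod_nat_const -(cardC1 a); congr (_ ^ _); apply: eq_card.
have A_gt0 : 0 < #|A| by apply/card_gt0P; exists a.
by rewrite -{2}(prednK A_gt0) expnS mulnAC mulnA leq_mul2r cP orbT.
Qed.

(** * Closeness up to a permutation of the seeds *)

(** Under a uniform seed [B \o sigma] has the law of [B], so [sigma] is a coupling. Couplings of
    this kind compose and can be built with part of the seed frozen. *)
Definition close (S : finType) (V : eqType) (K c : nat) (A B : S -> V) : Prop :=
  exists sigma : {perm S}, rare K c [pred s | A s != B (sigma s)].

Section Close.
Variables (S : finType) (V : eqType) (K : nat).
Implicit Types A B C : S -> V.

Lemma eq_close c A A' B B' : A =1 A' -> B =1 B' -> close K c A B -> close K c A' B'.
Proof.
move=> eA eB [sg cAB]; exists sg; apply: rare_sub cAB => s.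
by rewrite !inE eA eB.
Qed.

Lemma close_refl c A : close K c A A.
Proof.
exists 1%g; rewrite /rare eq_card0 // => s; by rewrite !inE perm1 eqxx.
Qed.

Lemma rare_preim_perm c (sg : {perm S}) (P : pred S) :
  rare K c (preim sg P) = rare K c P.
Proof.
rewrite /rare -[#|preim sg P|](card_image (@perm_inj _ sg)).
congr (_ * _ <= _); apply: eq_card => s.
by rewrite -[s](permKV sg) mem_image ?inE //; apply: perm_inj.
Qed.

Lemma close_sym c A B : close K c A B -> close K c B A.
Proof.
case=> sg cAB; exists (sg^-1)%g; rewrite -(rare_preim_perm _ sg).
by apply: rare_sub cAB => s; rewrite !inE permK eq_sym.
Qed.

Lemma close_trans B A C c d :
  close K c A B -> close K d B C -> close K (c + d) A C.
Proof.
case=> sg cAB [tau cBC]; exists (sg * tau)%g.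
rewrite -(rare_preim_perm _ sg) in cBC.
apply: rare_sub (rare_predU cAB cBC) => s; rewrite !inE permM.
by case: (A s =P B (sg s)) => // ->.
Qed.

End Close.

(** The permutations chosen on the fibres over each [s] glue to a permutation of all pairs. *)
Lemma close_pair (S T : finType) (V : eqType) K c (A B : S * T -> V) :
  (forall s, close K c (fun t => A (s, t)) (fun t => B (s, t))) ->
  close K c A B.
Proof.
move=> /fin_all_exists[sg cAB].
have inj : injective (fun x : S * T => (x.1, sg x.1 x.2)).
  by move=> [s t] [s' t'] /= [<- /perm_inj <-].
exists (perm inj); apply: rare_pair => s; apply: rare_sub (cAB s) => t.
by rewrite !inE permE.
Qed.

Lemma close_pairl (S T : finType) (V : eqType) K c (A B : S * T -> V) :
  (forall t, close K c (fun s => A (s, t)) (fun s => B (s, t))) ->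
  close K c A B.
Proof.
move=> cAB; pose sw (U U' : finType) (x : U * U') := (x.2, x.1).
have [|sg cAB'] := @close_pair T S V K c (A \o @sw T S) (B \o @sw T S); first exact: cAB.
have inj : injective (fun x => sw _ _ (sg (sw S T x))).
  by move=> [s t] [s' t'] [/= e1 e2]; have /perm_inj[-> ->] : sg (t, s) = sg (t', s')
    by rewrite [LHS]surjective_pairing e1 e2 -surjective_pairing.
exists (perm inj); move: cAB'.
rewrite /rare !card_prod (mulnC #|S|); congr (_ * _ <= _).
have swI : injective (sw T S) by move=> [? ?] [? ?] [-> ->].
rewrite -(card_image swI); apply: eq_card => -[s t].
by rewrite -[(s, t)]/(sw _ _ (t, s)) (mem_image swI) !inE permE /=; case: (sg _).
Qed.

(** * Cyclic shifts and residues on an interval *)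

Section CyclicShift.
Variables (K c q : nat).
Local Notation Z := 'I_q.+1.

Lemma rare_ord_ge d (P : pred Z) :
  (forall w, P w -> q.+1 <= w + d) -> d * K <= c * q.+1 -> rare K c P.
Proof.
move=> Pd; rewrite /rare card_ord; apply: leq_trans; rewrite leq_mul2r.
case: (posnP K) => //= _.
case: d Pd => [|d] Pd.
  by rewrite leqn0; apply/eqP/eq_card0 => w; apply/negP => /Pd; rewrite addn0 leqNgt ltn_ord.
have injf : {in P &, injective (fun w : Z => inord (q - w) : 'I_d.+1)}.
  move=> v w /Pd lv /Pd lw /(congr1 val); rewrite /= !inordK; try lia.
  by move=> e; apply: val_inj => /=; move: (ltn_ord v) (ltn_ord w); lia.
by rewrite -(card_in_image injf) -[X in _ <= X]card_ord max_card.
Qed.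

(** The permutation is translation by [d] modulo [q.+1]; it differs from true translation only on
    the last [d] points, where it wraps around. *)
Lemma close_shift (V : eqType) d (G : nat -> V) :
  d * K <= c * q.+1 ->
  close K c (fun w : Z => G (w + d)) (fun w : Z => G w).
Proof.
move=> dK.
exists (perm (@GRing.addIr _ (inZp d : Z))).
apply: rare_ord_ge dK => w; rewrite !inE permE; apply: contraNT; rewrite -ltnNge => lt.
by rewrite /= modnDmr modn_small.
Qed.

(** As [m] divides [q.+1], residues are equidistributed; a point is determined by its quotient and
    its residue. *)
Lemma rare_mod_lt m d (P : pred Z) :
  (m %| q.+1) -> (forall w, P w -> w %% m < d) ->
  d * K <= c * m -> rare K c P.
Proof.
move=> mq Pd dK; rewrite /rare card_ord -[X in c * X](divnK mq) mulnCA.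
set k := q.+1 %/ m; have m_gt0 : 0 < m by apply: dvdn_gt0 mq.
apply: leq_trans (leq_mul (leqnn k) dK); rewrite mulnA leq_mul2r.
apply/orP; right.
have lt_k (w : Z) : w %/ m < k by rewrite ltn_divLR // divnK // ltn_ord.
case: d Pd {dK} => [|d] Pd.
  by rewrite muln0 leqn0; apply/eqP/eq_card0 => w; apply/negP => /Pd.
pose f (w : Z) : 'I_k * 'I_d.+1 := (Ordinal (lt_k w), inord (w %% m)).
have injf : {in P &, injective f}.
  move=> v w /Pd lv /Pd lw [edv /(congr1 val)]; rewrite /= !inordK // => emod.
  by apply: val_inj; rewrite /= (divn_eq v m) (divn_eq w m) edv emod.
rewrite -(card_in_image injf) (leq_trans (max_card _)) //.
by rewrite card_prod !card_ord.
Qed.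

End CyclicShift.

(** * The construction for two and three variables *)

Definition ranks_hidden (n N K c : nat) : Prop :=
  exists (S : finType) (X : S -> {ffun 'I_n -> 'I_N.+1}),
    [/\ 0 < #|S|, forall s i, 0 < X s i,
        forall s (i j : 'I_n), i < j -> X s i < X s j &
        forall I J : {set 'I_n}, #|I| = #|J| -> #|I| < n ->
          close K c (random_subset I \o X) (random_subset J \o X)].

Lemma ranks_hidden2 K : 0 < K -> ranks_hidden 2 K.+1 K 2.
Proof.
case: K => // q _.
pose X (w : 'I_q.+1) := [ffun i : 'I_2 => inord (w.+1 + i) : 'I_q.+3].
exists 'I_q.+1, X.
have val_X (w : 'I_q.+1) (i : 'I_2) : (inord (w.+1 + i) : 'I_q.+3) = w.+1 + i :> nat.
  by rewrite inordK //; move: (ltn_ord w) (ltn_ord i); lia.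
split=> [|s i|s i j lt_ij|I J].
- by rewrite card_ord.
- by rewrite ffunE val_X.
- by rewrite !ffunE !val_X ltn_add2l.
case def_m: #|I| => [|[|m]] //= cardJ _.
  move/eqP: def_m; rewrite cards_eq0 => /eqP->.
  by move/esym/eqP: cardJ; rewrite cards_eq0 => /eqP->; apply: close_refl.
have close1 i : close q.+1 1
    (random_subset [set i] \o X) (fun w : 'I_q.+1 => [set inord w.+1]).
  have iK : i * q.+1 <= 1 * q.+1 by rewrite leq_mul2r -ltnS ltn_ord.
  apply: eq_close (close_shift (fun w => [set inord w.+1]) iK) => // w.
  by rewrite /= /random_subset imset_set1 ffunE addSn.
have/eqP/cards1P[i ->] := def_m; have/esym/eqP/cards1P[j ->] := cardJ.
exact: close_trans (close1 i) (close_sym (close1 j)).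
Qed.

Lemma ranks_hidden3 K : 0 < K -> ranks_hidden 3 (2 ^ (2 * K).+1) K 4.
Proof.
case: K => // k _; set K := k.+1; set q := (2 ^ (2 * K)).-1.
have qE : q.+1 = 2 ^ (2 * K) by rewrite prednK // expn_gt0.
have KQ : 2 ^ K * K <= q.+1.
  by rewrite qE mul2n -addnn expnD leq_mul2l ltnW ?orbT // ltn_expl.
rewrite expnS -qE.
pose d (a i : nat) := if i is i'.+1 then 2 ^ (a + i') else 0.
pose X (t : 'I_q.+1 * 'I_K) := [ffun i : 'I_3 => inord (t.1.+1 + d t.2 i) : 'I_(2 * q.+1).+1].
have d_le (a : 'I_K) (i : 'I_3) : d a i <= 2 ^ K.
  case: i => -[|i] //= lt_i; rewrite leq_exp2l //; move: (ltn_ord a); lia.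
have val_X t i : X t i = t.1.+1 + d t.2 i :> nat.
  rewrite ffunE inordK // ltnS mul2n -addnn leq_add //.
  by rewrite (leq_trans (d_le _ _)) // (leq_trans _ KQ) // leq_pmulr.
have cardS : 0 < #|{: 'I_q.+1 * 'I_K}| by rewrite card_prod !card_ord.
exists ('I_q.+1 * 'I_K)%type, X; split=> // [t i|t i j lt_ij|].
- by rewrite val_X.
- rewrite !val_X ltn_add2l; case: i j lt_ij => -[|i] hi [[|j] hj] //=.
    by rewrite expn_gt0.
  by rewrite ltnS ltn_exp2l // ltn_add2l.
(* Reference set for each size; every subset is compared with it, at cost at most 2, whence the
   total 4. *)
pose C m (t : 'I_q.+1 * 'I_K) : {set 'I_(2 * q.+1).+1} := match m with
  | 0 => set0 | 1 => [set inord t.1.+1]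
  | _ => [set inord t.1.+1; inord (t.1.+1 + 2 ^ t.2)] end.
suff closeC (I : {set 'I_3}) : #|I| < 3 -> close K 2 (random_subset I \o X) (C #|I|).
  move=> I J eIJ I3; apply: close_trans (closeC I I3) (close_sym _).
  by rewrite eIJ in I3 *; apply: closeC.
have shift (f : 'I_K -> nat) (G : 'I_K -> nat -> {set 'I_(2 * q.+1).+1}) :
    (forall a, f a <= 2 ^ K) ->
    close K 1 (fun t : 'I_q.+1 * 'I_K => G t.2 (t.1 + f t.2)) (fun t => G t.2 t.1).
  move=> f_le; apply: close_pairl => a.
  have faK : f a * K <= 1 * q.+1.
    by rewrite mul1n (leq_trans _ KQ) // leq_mul2r f_le orbT.
  exact: close_shift (G a) faK.
have weaken (A B : 'I_q.+1 * 'I_K -> {set 'I_(2 * q.+1).+1}) : close K 1 A B -> close K 2 A B.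
  by move=> cAB; apply: close_trans cAB (close_refl _ _ _).
case def_m: #|I| => [|[|[|//]]] _.
- move/eqP: def_m; rewrite cards_eq0 => /eqP->.
  apply: eq_close (close_refl _ _ _) => // t; rewrite /= /random_subset imset0 //.
- have/eqP/cards1P[i ->] := def_m.
  apply: weaken; apply: eq_close (shift (d^~ i) (fun _ w => [set inord w.+1]) _) => // t.
  by rewrite /= /random_subset imset_set1 ffunE addSn.
have/cards1P[i CI] : #|~: I| == 1 by rewrite cardsCs setCK def_m card_ord.
have {def_m CI} -> : I = ~: [set i] by rewrite -CI setCK.
have setC0 : ~: [set ord0] = [set inord 1; inord 2] :> {set 'I_3}.
  by apply/setP=> j; rewrite !inE -!val_eqE /= !inordK //; case: j => -[|[|[|]]].
have setC1 : ~: [set inord 1] = [set ord0; inord 2] :> {set 'I_3}.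
  by apply/setP=> j; rewrite !inE -!val_eqE /= !inordK //; case: j => -[|[|[|]]].
have setC2 : ~: [set inord 2] = [set ord0; inord 1] :> {set 'I_3}.
  by apply/setP=> j; rewrite !inE -!val_eqE /= !inordK //; case: j => -[|[|[|]]].
have X2 t i1 i2 : random_subset [set i1; i2] (X t) = [set X t i1; X t i2].
  by rewrite /random_subset imsetU1 imset_set1.
have [->|[->|->]] : i = ord0 \/ i = inord 1 \/ i = inord 2.
  case: i => -[|[|[|//]]] lt_i; [left | right; left | right; right];
  by apply: val_inj; rewrite /= ?inordK //.
(* Omitting the first variable leaves the gap [2 ^ a], so moving the base point by [2 ^ a]
   suffices. *)
- rewrite setC0; apply: weaken.
  apply: eq_close (shift (fun a => 2 ^ a)
    (fun a w => [set inord w.+1; inord (w.+1 + 2 ^ a)]) _) => [t|t|a] //.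
    rewrite /= X2 !ffunE !inordK //= addn0 addn1.
    by congr [set inord _; inord _]; rewrite ?expnS; lia.
  by rewrite leq_exp2l // ltnW.
(* Omitting the middle variable leaves the gap [2 ^ a.+1]: with [w] frozen, the exponent is shifted
   cyclically by 1 among its [K] values. *)
- rewrite setC1; apply: weaken.
  apply: close_pair => w.
  have KK : 1 * K <= 1 * k.+1 by [].
  apply: eq_close (close_shift
    (fun a => [set inord w.+1; inord (w.+1 + 2 ^ a)]) KK) => // a.
  by rewrite /= X2 !ffunE !inordK //= addn0.
- rewrite setC2; apply: eq_close (close_refl _ _ _) => // t.
  by rewrite /= X2 !ffunE !inordK //= !addn0.
Qed.

(** * The inductive step, from n to n + 1 variables *)

(** Each of the two subsets costs [2 * n.+1]: 2 for moving the base point and 2 for each of the [n]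
    increments. The remaining [c] is the error of the induction hypothesis. *)
Lemma ranks_hiddenS n N K c : 0 < K -> ranks_hidden n N K c ->
  ranks_hidden n.+1 (2 * (2 ^ K) ^ N.+1) K (c + 4 * n.+1).
Proof.
move=> K_gt0 [S [Y [S_gt0 Y_gt0 Y_incr closeY]]].
set M := 2 ^ K; set q := (M ^ N.+1).-1.
have M_gt1 : 1 < M by rewrite -(expn0 2) ltn_exp2l.
have M_gt0 := ltnW M_gt1.
have KM : K <= M by rewrite ltnW // ltn_expl.
have qE : q.+1 = M ^ N.+1 by rewrite prednK // expn_gt0 M_gt0.
rewrite -qE; set N' := 2 * q.+1.
(* Since [M ^ y] divides [q.+1 = M ^ N.+1] for all [y <= N], one range serves for uniform residues
   modulo every [M ^ y]. *)
pose F := {ffun 'I_N.+1 -> 'I_q.+1}.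
(* The noise r is indexed by the value y of the Y_j, not by j: then C below
   depends on the selected Y_j only through the set of their values. *)
pose R (r : F) (y : 'I_N.+1) := M ^ y + r y %% M ^ y.
pose D (a : S * F) i := if unlift (@ord0 n) i is Some j then R a.2 (Y a.1 j) else 0.
pose X (t : S * F * 'I_q.+1) := [ffun i => inord (t.2.+1 + D t.1 i) : 'I_N'.+1].
have R_lt r y : R r y < 2 * M ^ y.
  by rewrite mul2n -addnn ltn_add2l ltn_mod expn_gt0 M_gt0.
have R_incr r (y z : 'I_N.+1) : y < z -> R r y < R r z.
  move=> lt_yz; apply: leq_trans (R_lt r y) (leq_trans _ (leq_addr _ _)).
  by apply: leq_trans (leq_pexp2l M_gt0 lt_yz); rewrite expnS leq_mul2r M_gt1 orbT.
have R_max r y : R r y <= 2 * M ^ N.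
  by rewrite (leq_trans (ltnW (R_lt r y))) // leq_mul2l leq_pexp2l // -ltnS.
have MNq : 2 * M ^ N <= q.+1 by rewrite qE expnS leq_mul2r M_gt1 orbT.
have val_X t i : X t i = t.2.+1 + D t.1 i :> nat.
  rewrite ffunE inordK // ltnS /N' mul2n -addnn leq_add // /D.
  by case: unlift => // j; apply: leq_trans MNq.
exists (S * F * 'I_q.+1)%type, X; split=> [|t i|t i j lt_ij|].
- by rewrite !card_prod card_ffun !card_ord !muln_gt0 S_gt0 expn_gt0.
- by rewrite val_X.
- rewrite !val_X ltn_add2l /D; move: lt_ij.
  case: (unliftP ord0 j) => [j' ->|-> //]; case: (unliftP ord0 i) => [i' ->|->] lt_ij.
    by apply: R_incr; apply: Y_incr.
  by rewrite addn_gt0 expn_gt0 M_gt0.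
pose C (I : {set 'I_n}) (t : S * F * 'I_q.+1) : {set 'I_N'.+1} :=
  inord t.2.+1 |: [set inord (t.2.+1 + R t.1.2 y) | y in random_subset I (Y t.1.1)].
suff closeC (I : {set 'I_n.+1}) : 0 < #|I| -> exists2 I' : {set 'I_n}, #|I'|.+1 = #|I| &
    close K (2 * n.+1) (random_subset I \o X) (C I').
  move=> I J eIJ ltIn; have [I0|I_gt0] := posnP #|I|.
    rewrite (cards0_eq I0); rewrite eIJ in I0.
    by rewrite (cards0_eq I0); apply: close_refl.
  have [I' eI cI] := closeC I I_gt0; rewrite eIJ in I_gt0.
  have [J' eJ cJ] := closeC J I_gt0.
  have -> : c + 4 * n.+1 = 2 * n.+1 + (c + 2 * n.+1) by lia.
  apply: close_trans cI (close_trans _ (close_sym cJ)).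
  (* With [w] and [r] frozen, both sides apply the same function to the selected sets of
     [Y]-values. *)
  apply: close_pairl => w; apply: close_pairl => r.
  have [||sg cY] := closeY I' J'; [lia|lia|].
  exists sg; apply: rare_sub cY => s; rewrite !inE /C /=.
  by apply: contraNneq => ->.
move=> /card_gt0P[i1 i1I].
have [i0 i0I i0_min] := arg_minnP (@nat_of_ord n.+1) i1I.
have {}i0I : i0 \in I := i0I.
(* Only the smallest element of [I] can be [ord0], so all the others are lifts. *)
pose I' := [set j | lift ord0 j \in I :\ i0].
have I'E : lift ord0 @: I' = I :\ i0.
  apply/setP=> i; apply/imsetP/idP => [[j]|]; first by rewrite inE => jI ->.
  case: (unliftP ord0 i) => [j ->|->] iI; first by exists j => //; rewrite inE.
  move: iI; rewrite !inE => /andP[/eqP i0_neq0 /i0_min].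
  by rewrite leqn0 => /eqP i00; case: i0_neq0; apply: val_inj.
exists I'.
  by rewrite -(card_imset _ (@lift_inj _ ord0)) I'E (cardsD1 i0 I) i0I.
have XE t : random_subset I (X t) = inord (t.2.+1 + D t.1 i0) |:
    [set inord (t.2.+1 + R t.1.2 y) | y in random_subset I' (Y t.1.1)].
  rewrite /random_subset -(setD1K i0I) imsetU1 -I'E ffunE -!imset_comp.
  congr (_ |: _); apply: eq_imset => j; rewrite /= ffunE /D liftK //.
case: (unliftP ord0 i0) => [j0 i0E|i0E]; last first.
  apply: eq_close (close_refl _ _ _) => // t.
  by rewrite /= XE /D i0E unlift_none addn0.
have D_i0 a : D a i0 = R a.2 (Y a.1 j0) by rewrite /D i0E liftK.
have I'_gt j : j \in I' -> j0 < j.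
  rewrite !inE i0E (inj_eq lift_inj) => /andP[nj /i0_min].
  by rewrite i0E /= /bump /= !add1n ltnS ltn_neqAle eq_sym nj.
(* Halfway set: the base point is already the smallest selected element, while the increments are
   still differences. They are not truncated, because [j0 < j] for every [j] in [I']. *)
pose E (a : S * F) w : {set 'I_N'.+1} :=
  inord w.+1 |: [set inord (w.+1 + (R a.2 y - D a i0)) | y in random_subset I' (Y a.1)].
have -> : 2 * n.+1 = 2 + n * 2 by lia.
apply: (@close_trans _ _ _ (fun t : S * F * 'I_q.+1 => E t.1 t.2)).
  apply: close_pair => a.
  have D_le : D a i0 * K <= 2 * q.+1.
    by rewrite qE (expnSr M) mulnA leq_mul // D_i0.
  apply: eq_close (close_shift (E a) D_le) => // w.
  rewrite /= XE /E /= -addSn; congr (_ |: _); apply: eq_in_imset => _ /imsetP[j jI' ->].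
  rewrite -addnA subnKC // D_i0 ltnW // R_incr // Y_incr //; exact: I'_gt.
apply: close_pairl => w; apply: close_pair => s.
set y0 := Y s j0.
(* The shift R r y0 depends on r, but only through r y0, which Phi keeps. *)
pose Phi (r : F) : F := [ffun y : 'I_N.+1 => if y <= y0 then r y else (r y - inZp (R r y0))%R].
have Phi_inj : injective Phi.
  move=> r r' /ffunP eqPhi.
  have eq0 : r y0 = r' y0 by have := eqPhi y0; rewrite !ffunE leqnn.
  apply/ffunP=> y; have := eqPhi y; rewrite !ffunE /R eq0.
  by case: ifP => // _ /GRing.addIr.
exists (perm Phi_inj); rewrite -[X in X * 2]card_ord.
(* Subtracting [R r y0 < 2 * M ^ y0] commutes with reduction modulo [M ^ y], [y0 < y], unless the
   residue is below [2 * M ^ y.-1]. That has density at most [2 / M <= 2 / K] for each [j]. *)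
apply: rare_sub (@rare_exists _ _ _ _
    (fun j : 'I_n => [pred r : F | r (Y s j) %% M ^ Y s j < 2 * M ^ (Y s j).-1]) _); last first.
  move=> j; apply: (@rare_ffun _ _ _ _ _ [pred z : 'I_q.+1 | z %% M ^ Y s j < 2 * M ^ (Y s j).-1]).
  apply: (@rare_mod_lt _ _ _ (M ^ Y s j) (2 * M ^ (Y s j).-1)) => //.
    by rewrite qE dvdn_exp2l // ltnW.
  by rewrite -mulnA leq_mul2l -[in X in _ <= X](prednK (Y_gt0 s j)) expnSr leq_mul.
move=> r; rewrite !inE permE; apply: contraNT; rewrite negb_exists => /forallP good.
apply/eqP; rewrite /E /C /=; congr (_ |: _); apply: eq_in_imset => _ /imsetP[j jI' ->].
have lt_y : y0 < Y s j by apply/Y_incr/I'_gt.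
congr (inord (_ + _)); rewrite D_i0 /= -/y0 /R ffunE ifN -?ltnNge //.
move: (good j); rewrite inE -leqNgt => good_j.
set y := Y s j in lt_y good_j *; rewrite -/(R r y0); set d := R r y0.
have d_le : d <= r y %% M ^ y.
  apply: leq_trans good_j; rewrite (leq_trans (ltnW (R_lt _ _))) // leq_mul2l leq_pexp2l //.
  by rewrite -ltnS prednK // (leq_ltn_trans _ lt_y).
have -> : (r y - inZp d)%R = inZp (r y - d) :> 'I_q.+1.
  apply/eqP; rewrite GRing.subr_eq; apply/eqP/val_inj.
  rewrite /= modnDm subnK ?modn_small //.
  by rewrite (leq_trans d_le) // leq_mod.
rewrite -addnBA //; congr (_ + _).
rewrite /= (modn_small (leq_ltn_trans (leq_subr _ _) (ltn_ord _))).
rewrite {2}(divn_eq (r y) (M ^ y)) -addnBA // modnMDl [RHS]modn_small //.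
by rewrite (leq_ltn_trans (leq_subr _ _)) // ltn_mod expn_gt0 M_gt0.
Qed.

(** * Growth of the range *)

(* The case k = 1 is separate: the general step, applied to k = 0, would give
   2 ^ Theta(K ^ 2) instead of 2 ^ Theta(K). *)
Fixpoint tower_bound (k K : nat) : nat :=
  match k with
  | 0 => K.+1
  | 1 => 2 ^ (2 * K).+1
  | k'.+1 => 2 * (2 ^ K) ^ (tower_bound k' K).+1
  end.

Lemma ranks_hidden_tower k : exists c, forall K, 0 < K ->
  ranks_hidden k.+2 (tower_bound k K) K c.
Proof.
elim: k => [|[_|k [c IH]]]; first by exists 2; apply: ranks_hidden2.
  by exists 4; apply: ranks_hidden3.
by exists (c + 4 * k.+4) => K K_gt0; apply: ranks_hiddenS (IH K K_gt0).
Qed.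

Lemma leq_self_iter_expn2 k x : x <= iter k (expn 2) x.
Proof.
by elim: k => // k IH; rewrite (leq_trans IH) // ltnW // ltn_expl.
Qed.

(** For [y >= 1], [3 * 2 ^ y <= 2 ^ (2 * y) * 2 ^ y]. *)
Lemma iter_expn2_triple k x : 0 < x -> 3 * iter k (expn 2) x <= iter k (expn 2) (3 * x).
Proof.
move=> x_gt0; elim: k => //= k IH; apply: leq_trans (leq_pexp2l _ IH) => //.
have y_gt0 := leq_trans x_gt0 (leq_self_iter_expn2 k x).
move: (iter k (expn 2) x) y_gt0 => [//|y] _.
have y4 : 3 <= 2 ^ (2 * y.+1).
  by rewrite mulnS expnD (@leq_trans (2 ^ 2 * 1)) // leq_mul2l expn_gt0.
by apply: leq_trans (leq_mul y4 (leqnn _)) _; rewrite -expnD -mulSnr.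
Qed.

Lemma tower_boundSS k K :
  tower_bound k.+2 K = 2 ^ (K * (tower_bound k.+1 K).+1).+1.
Proof. by rewrite expnS expnM. Qed.

Lemma iter_expn2_leq_tower k K : 0 < K -> iter k (expn 2) K <= tower_bound k K.
Proof.
move=> K_gt0; elim: k => [|[_|k IH]]; first exact: leqnSn.
  by apply: leq_pexp2l => //=; lia.
rewrite tower_boundSS iterS leq_exp2l // (leq_trans IH) //.
by rewrite (leq_trans (leqnSn _)) // (leq_trans (leq_pmull _ K_gt0)).
Qed.

(** With [K < N] the new exponent [(K * N.+1).+1] is at most [N ^ 3]. Cubing a power of 2 triples
    its exponent, and [iter_expn2_triple] moves this 3 into the argument: one factor 3 per level. *)
Lemma tower_leq_iter_expn2 k K : 0 < K ->
  tower_bound k K <= iter k (expn 2) (3 ^ k.+1 * K).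
Proof.
move=> K_gt0; elim: k => [|[_|k IH]]; first by rewrite /=; lia.
  by apply: leq_pexp2l => //=; lia.
have KN := iter_expn2_leq_tower k.+1 K_gt0.
have ltK : K < iter k.+1 (expn 2) K.
  by rewrite (leq_ltn_trans (leq_self_iter_expn2 k K)) // iterS ltn_expl.
rewrite tower_boundSS; set N := tower_bound k.+1 K in IH KN *.
rewrite iterS leq_exp2l //.
apply: (@leq_trans (N ^ 3)).
  have : K < N by apply: leq_trans KN.
  rewrite !expnS expn0; nia.
move: IH; rewrite iterS [3 ^ k.+3]expnS -mulnA iterS; set x := 3 ^ k.+2 * K => IH.
apply: (@leq_trans ((2 ^ iter k (expn 2) x) ^ 3)); first by rewrite leq_exp2r.
rewrite -expnM leq_exp2l // mulnC iter_expn2_triple //.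
by rewrite muln_gt0 expn_gt0.
Qed.

(** * From seed permutations to total variation *)

Local Open Scope ring_scope.

Section Pushforward.
Variables (R : realType) (S T : finType) (X : S -> T).
Hypothesis S_gt0 : (0 < #|S|)%N.

Definition pushforward : {ffun T -> R} :=
  [ffun x => #|[pred s | X s == x]|%:R / #|S|%:R].

Lemma Pr_eq_pushforward (V : finType) (A : T -> V) v :
  Pr_eq pushforward A v = #|[pred s | A (X s) == v]|%:R / #|S|%:R.
Proof.
rewrite /Pr_eq; under eq_bigr do rewrite ffunE.
rewrite -big_distrl -natr_sum /=; congr (_%:R / _).
rewrite -[RHS]sum1_card (partition_big X (fun x => A x == v)) //=.
apply: eq_bigr => x /eqP Ax; rewrite -sum1_card; apply: eq_bigl => s.
by rewrite !inE; case: (X s =P x) => [->|]; rewrite ?Ax ?eqxx ?andbF.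
Qed.

Lemma is_distribution_pushforward : is_distribution pushforward.
Proof.
split=> [x|]; first by rewrite ffunE divr_ge0 ?ler0n.
have := @Pr_eq_pushforward unit (fun=> tt) tt.
rewrite /Pr_eq (eq_bigl predT) // => ->; rewrite (eq_card (B := S)) //.
by rewrite divff // pnatr_eq0 -lt0n.
Qed.

(** As [sg] preserves counts, the positive part at [v] is at most the mass of bad seeds with
    [A]-value [v]; these masses sum to the density of [bad]. *)
Lemma tv_dist_pushforward (V : finType) (A B : T -> V) K c : (0 < K)%N ->
  close K c (A \o X) (B \o X) -> tv_dist pushforward A B <= c%:R / K%:R.
Proof.
move=> K_gt0 [sg cAB]; pose bad := [pred s | A (X s) != B (X (sg s))].
have S_gt0' : 0 < #|S|%:R :> R by rewrite ltr0n.
apply: (@le_trans _ _ (#|bad|%:R / #|S|%:R)); last first.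
  rewrite ler_pdivrMr // mulrAC ler_pdivlMr ?ltr0n // -!natrM ler_nat.
  exact: cAB.
rewrite -[#|bad|](_ : \sum_v #|[pred s | bad s && (A (X s) == v)]| = _)%N; last first.
  rewrite -[RHS]sum1_card (partition_big (A \o X) predT) //=.
  by apply: eq_bigr => v _; rewrite -sum1_card.
rewrite natr_sum big_distrl /=; apply: ler_sum => v _.
rewrite ge_max divr_ge0 ?ler0n // andbT !Pr_eq_pushforward -mulrBl.
rewrite ler_pM2r ?invr_gt0 // lerBlDr -natrD ler_nat.
have <- : #|[pred s | B (X (sg s)) == v]| = #|[pred s | B (X s) == v]|.
  rewrite -(card_image (@perm_inj _ sg)); apply: eq_card => s.
  by rewrite -[s](permKV sg) (mem_image (@perm_inj _ sg)) !inE.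
rewrite -cardUI; apply: leq_trans (leq_addr _ _); apply: subset_leq_card.
apply/subsetP=> s; rewrite !inE => /eqP <-; rewrite eqxx andbT eq_sym.
by case: eqP.
Qed.

End Pushforward.

(** * Choice of K in terms of eps, and conclusion *)

Lemma iter_exp2_natr (R : realType) k (x : nat) :
  iter k (@exp2 R) x%:R = (iter k (expn 2) x)%:R.
Proof.
by elim: k => // k IH; rewrite !iterS IH /exp2 powR_mulrn ?ler0n // -natrX.
Qed.

Lemma le_iter_exp2 (R : realType) k : {homo iter k (@exp2 R) : x y / x <= y}.
Proof.
elim: k => // k IH x y /IH le_xy; rewrite !iterS /exp2.
by apply: ler_powR => //; rewrite ler1n.
Qed.

Theorem corollary29 (R : realType) (n : nat) (hn : (2 <= n)%N) :
  exists N : R -> nat,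
    iter_exp2_Theta_inv (n - 2) (fun eps : R => (N eps)%:R) /\
    forall eps : R, 0 < eps ->
      exists p : {ffun {ffun 'I_n -> 'I_(N eps).+1} -> R},
        [/\ is_distribution p,
            positive_increasing p &
            indistinguishable_subsets p eps].
Proof.
case: n hn => [|[|k]] // _; rewrite (_ : k.+2 - 2 = k)%N; last by rewrite subSS subSS subn0.
have [c hidden] := ranks_hidden_tower k.
(* Taking [c.+1] instead of [c] gives both [c / K <= eps] and [1 / eps <= K], the latter for the
   lower bound on the range. *)
pose K (eps : R) := (Num.truncn (c.+1%:R / eps)).+1.
have K_gt (eps : R) : c.+1%:R / eps < (K eps)%:R by apply: truncnS_gt.
exists (fun eps => tower_bound k (K eps)); split.
  (* For [eps < 1], [K eps <= c.+1 / eps + 1 <= c.+2 / eps]; the power of 3 comes from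
     [tower_leq_iter_expn2]. *)
  exists 1, (3 ^ k.+1 * c.+2)%:R, 1; split=> // [|eps /andP[eps_gt0 eps_lt1]].
    by rewrite ltr0n muln_gt0 expn_gt0.
  have inv_gt1 : 1 < eps^-1 by rewrite invf_gt1.
  apply/andP; split.
    apply: (@le_trans _ _ (iter k (@exp2 R) (K eps)%:R)).
      apply: le_iter_exp2; apply: le_trans (ltW (K_gt eps)).
      by rewrite ler_pM2r ?invr_gt0 // ler1n.
    by rewrite iter_exp2_natr ler_nat iter_expn2_leq_tower.
  apply: (@le_trans _ _ (iter k (@exp2 R) (3 ^ k.+1 * K eps)%:R)).
    by rewrite iter_exp2_natr ler_nat tower_leq_iter_expn2.
  apply: le_iter_exp2; rewrite !natrM -mulrA ler_pM2l ?ltr0n ?expn_gt0 //.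
  rewrite /K -[X in X%:R <= _]addn1 -[X in _ <= X%:R / _]addn1 !natrD mulrDl mul1r.
  apply: lerD; last exact: ltW.
  by rewrite truncn_le divr_ge0 // ltW.
move=> eps eps_gt0; have K_gt0 : (0 < K eps)%N by [].
have [S [X [S_gt0 X_gt0 X_incr closeX]]] := hidden _ K_gt0.
exists (pushforward R X); split; first exact: is_distribution_pushforward.
  move=> x; rewrite ffunE => px.
  have /card_gt0P[s /eqP <-] : (0 < #|[pred s | X s == x]|)%N.
    by rewrite lt0n; apply: contraTneq px => ->; rewrite mul0r ltxx.
  by split; [apply: X_gt0 | apply: X_incr].
move=> m lt_mn I J Im Jm; apply: (@le_trans _ _ (c%:R / (K eps)%:R)).
  apply: tv_dist_pushforward => //; apply: closeX; first by rewrite Im Jm.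
  by rewrite Im.
rewrite ler_pdivrMr ?ltr0n // mulrC -ler_pdivrMr // (le_trans _ (ltW (K_gt eps))) //.
by rewrite ler_pM2r ?invr_gt0 // ler_nat.
Qed.
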